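(* Let $n$ be an integer greater than $3$. If $\vartheta(A_n,1)\geq 2$, then $\delta(A_n)\geq\delta(A_{n-1})+2$.
   Context: Polygons are treated combinatorially: a convex polygon is a finite set of vertices with a clockwise cyclic order; edges are $2$-element vertex sets, two edges cross if disjoint with alternating vertices in the cyclic order; a triangulation is an inclusion-maximal set of pairwise non-crossing edges; a flip replaces an interior edge $\varepsilon$ of $T$ by the other diagonal of the unique quadrilateral with diagonal $\varepsilon$ and sides in $T$. For a pair $P=\{U,V\}$, $\delta(P)$ is the minimum number of flips transforming $U$ into $V$; a path realizing it is geodesic. For a vertex $a$ with clockwise successor $b$ and a triangulation $T$, $\mathrm{lk}_T(\{a,b\})$ is the unique vertex $x$ with $\{a,x\},\{b,x\}\in T$; a flip $T\to T'$ is incident to $\{a,b\}$ if the links differ; $\vartheta(P,a)$ is the maximum over geodesic paths between $U$ and $V$ of the number of flips incident to $\{a,b\}$. Deletion: for a vertex $a$ of a polygon with at least $4$ vertices, with clockwise successor $b$, $T\ominus a=\{\varepsilon \text{ with } a \text{ replaced by } b:\varepsilon\in T\setminus\{\{a,b\}\}\}$, a triangulation of the polygon with $a$ removed. Zigzag: for $N\geq 4$, on the polygon with vertices $0,\dots,N-1$ labeled clockwise (mod $N$), $Z_N$ is the triangulation whose interior edges are $\varepsilon_{2k+1}=\{2-k,4+k\}$ and $\varepsilon_{2k+2}=\{1-k,4+k\}$ ($k\geq0$), for indices $1,\dots,N-3$. In a polygon with $N$ vertices, $\bar k=k+\lfloor N/2\rfloor$. Pair $A_n$ ($n\geq3$):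 $A_n^-$ is $Z_{n+4}$ with $0,1,\bar0,\bar1$ deleted successively ($\bar k=k+\lfloor (n+4)/2\rfloor$), remaining vertices relabeled clockwise $0,\dots,n-1$ with vertex $2$ keeping label $2$; $A_n^+$ is $Z_{n+4}$ with $4,5,\bar4,\bar5$ deleted successively, relabeled clockwise $0,\dots,n-1$ with former vertex $2$ getting label $1$. Both are triangulations of the polygon with vertices $0,\dots,n-1$; $A_n=\{A_n^-,A_n^+\}$. *)

(* Defs.v *)
From HB Require Import structures.
From mathcomp Require Import all_boot all_order all_algebra.

Set Implicit Arguments.
Unset Strict Implicit.
Unset Printing Implicit Defensive.

(* A polygon is a set V of labels in 'I_N, whose clockwise cyclic order is     *)
(* inherited from the increasing order of the labels; [set: 'I_N] is the       *)
(* polygon with vertices 0, ..., N-1 labeled clockwise. Edges are 2-element    *)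
(* sets of vertices, and triangulations contain the boundary edges.            *)

(* a, b, c are pairwise distinct and met in this order going clockwise. *)
Definition cw (a b c : nat) : bool :=
  [|| a < b < c, b < c < a | c < a < b].

Section Polygon.

Variable N : nat.
Implicit Types (V : {set 'I_N}) (a b : 'I_N) (e f : {set 'I_N}).
Implicit Types (T U : {set {set 'I_N}}) (P : {set {set 'I_N}} * {set {set 'I_N}}).

Definition edges V : {set {set 'I_N}} := [set e : {set 'I_N} | (e \subset V) && (#|e| == 2)].

Definition crossing e f : bool :=
  [disjoint e & f] &&
  [exists a in e, exists b in e, exists c in f, exists d in f,
     cw a c b && cw b d a].

Definition noncrossing T : bool :=
  [forall e in T, forall f in T, ~~ crossing e f].

Definition triangulation V T : bool :=
  maxset (fun S : {set {set 'I_N}} => (S \subset edges V) && noncrossing S) T.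

(* The clockwise successor of a in V (enum V is increasing). *)
Definition succ V a : 'I_N := next (enum V) a.

Definition boundary V : {set {set 'I_N}} := [set [set a; succ V a] | a in V].

(* The flip in the quadrilateral a, b, c, d exchanging {a, c} for {b, d}. *)
Definition flip V T T' : bool :=
  [&& triangulation V T, triangulation V T' &
    [exists a : 'I_N, exists b : 'I_N, exists c : 'I_N, exists d : 'I_N,
      [&& cw a b c, cw c d a, [set a; c] \in T :\: boundary V,
          [set a; b] \in T, [set b; c] \in T, [set c; d] \in T, [set d; a] \in T
        & T' == [set b; d] |: (T :\ [set a; c])]]].

(* p lists the triangulations following P.1 on a path from P.1 to P.2, so that *)
(* size p is the number of flips.                                              *)
Definition flip_path V P (p : seq {set {set 'I_N}}) : bool :=
  path (flip V) P.1 p && (last P.1 p == P.2).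

(* A shortest path has fewer flips than there are sets of edges, whence the    *)
(* bounded search (see deltaP); the default value when there is no path at all *)
(* is irrelevant for pairs of triangulations, as flip-graphs are connected.    *)
Definition delta V P : nat :=
  find (fun k => [exists p : k.-tuple {set {set 'I_N}}, flip_path V P p])
       (iota 0 #|{: {set {set 'I_N}}}|).

Definition link V T a : option 'I_N :=
  [pick x | ([set a; x] \in T) && ([set succ V a; x] \in T)].

Definition incident V a T T' : bool := link V T a != link V T' a.

Definition nb_incident V a T (p : seq {set {set 'I_N}}) : nat :=
  count id (pairmap (incident V a) T p).

Definition theta V P a : nat :=
  \max_(p : (delta V P).-tuple {set {set 'I_N}} | flip_path V P p)
     nb_incident V a P.1 p.

Definition deletion V T a : {set {set 'I_N}} :=
  [set [set (if x == a then succ V a else x) | x in e]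
     | e : {set 'I_N} in T :\ [set a; succ V a]].

Fixpoint deletions V T (s : seq 'I_N) : {set 'I_N} * {set {set 'I_N}} :=
  if s is a :: s' then deletions (V :\ a) (deletion V T a) s' else (V, T).

(* Relabeling of the vertices of V clockwise by 0, ..., n-1 (n = #|V|) so that *)
(* v gets label c <= n: the vertex labeled j is reached from v in j - c (mod n)*)
(* clockwise steps.                                                            *)
Definition vertex_of_label (n : nat) V (v : 'I_N) (c : nat) (j : 'I_n) : 'I_N :=
  iter ((j + (n - c)) %% n) (succ V) v.

Definition relabel (n : nat) V T (v : 'I_N) (c : nat) : {set {set 'I_n}} :=
  [set e : {set 'I_n} | vertex_of_label V v c @: e \in T].

Lemma deltaP V P p : flip_path V P p ->
  (exists q, flip_path V P q /\ size q = delta V P) /\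
  (forall q, flip_path V P q -> delta V P <= size q).
Proof.
move=> Pp; pose D k := [exists p : k.-tuple {set {set 'I_N}}, flip_path V P p].
have D_path q : flip_path V P q -> D (size q).
  by move=> Pq; apply/existsP; exists (in_tuple q).
pose m := #|{: {set {set 'I_N}}}|.
have hasD : has D (iota 0 m).
  have /andP[pathp /eqP lastp] := Pp.
  case/shortenP: pathp lastp => p' pathp' uniqp' _ lastp'.
  apply/hasP; exists (size p').
    rewrite mem_iota /= add0n.
    by have := max_card (mem (P.1 :: p')); rewrite (card_uniqP uniqp').
  by apply: D_path; rewrite /flip_path pathp' lastp' eqxx.
have ltDm : delta V P < m by move: hasD; rewrite has_find size_iota.
split=> [|q Pq].
  have := nth_find 0 hasD; rewrite nth_iota // add0n => /existsP[q Pq].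
  by exists q; rewrite size_tuple.
rewrite leqNgt; apply/negP => lt_q.
have := @before_find _ 0 D (iota 0 m) _ lt_q.
by rewrite nth_iota ?(ltn_trans lt_q) // add0n D_path.
Qed.

End Polygon.

Section PairA.

Local Open Scope ring_scope.

(* Labels modulo N = m + 4 are computed in the ring Z/NZ carried by 'I_m.+4. *)
Definition zigzag_edge (m i : nat) : {set 'I_m.+4} :=
  let k : 'I_m.+4 := (i.-1./2)%:R in
  if odd i then [set 2 - k; 4 + k] else [set 1 - k; 4 + k].

(* zigzag m is the triangulation Z_N for N = m + 4. *)
Definition zigzag (m : nat) : {set {set 'I_m.+4}} :=
  boundary [set: 'I_m.+4] :|: [set zigzag_edge m i.+1 | i : 'I_m.+1].

Definition bar (m : nat) (k : 'I_m.+4) : 'I_m.+4 := k + (m.+4./2)%:R.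

Definition A_minus (n : nat) : {set {set 'I_n}} :=
  let VT := deletions [set: 'I_n.+4] (zigzag n) [:: 0; 1; bar 0; bar 1] in
  relabel n VT.1 VT.2 2 2.

Definition A_plus (n : nat) : {set {set 'I_n}} :=
  let VT := deletions [set: 'I_n.+4] (zigzag n) [:: 4; 5; bar 4; bar 5] in
  relabel n VT.1 VT.2 2 1.

Definition A (n : nat) : {set {set 'I_n}} * {set {set 'I_n}} :=
  (A_minus n, A_plus n).

End PairA.

(* Main.v *)
Require Import Defs.
From mathcomp Require Import all_boot all_order all_algebra.
From mathcomp Require Import zify.

Set Implicit Arguments.
Unset Strict Implicit.
Unset Printing Implicit Defensive.

(* Contracting the boundary edge {1, 2} of the n-gon sends a triangulation to  *)
(* a triangulation of the (n-1)-gon, and a flip to a flip or to an equality;   *)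
(* the flips incident to {1, 2} are sent to equalities. A geodesic with at     *)
(* least two flips incident to {1, 2} is thus sent to a path that is shorter   *)
(* by at least 2. Composing the contraction with the reflection x |-> 5 - x    *)
(* modulo n - 1 exchanges the two ends of the pair: it maps A_n^- to           *)
(* A_(n-1)^+ and A_n^+ to A_(n-1)^-, so that this path, read backwards, joins  *)
(* A_(n-1)^- to A_(n-1)^+.                                                     *)

(** Contracting a boundary edge sends triangulations to triangulations ([collapse_triangulation]). A
    flip takes place in a quadrilateral. If both ends of the contracted edge are corners of it, that
    edge is a side, the quadrilateral shrinks to a triangle whichever diagonal it carries, and the
    flip disappears ([quad_collapse_eq]). Otherwise the quadrilateral survives, and the flip with it
    ([quad_collapse_flip]). An incident flip is of the first kind ([quad_flip_link]), so
    [collapse_path] shortens a path by at least its number of incident flips.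

    It remains to recognize the contracted ends. Deletion, relabeling and contraction are all images
    under maps of vertices, so each end is the [collapse] of a single zigzag along an explicit map
    ([A_minusE], [A_plusE]). Reflection matches the interior edge of index i of Z_(m+5) with the one
    of index i - 1 of Z_(m+4), the merged vertices match as well, and the first interior edge brings
    nothing new. [zigzag_collapse_eq] turns this into [fold_A_minus] and [fold_A_plus]. *)

Ltac cw_lia := rewrite /cw; clear; lia.

Lemma cw_total (a b c : nat) : a != b -> b != c -> c != a -> cw a b c || cw c b a.
Proof. cw_lia. Qed.

Lemma cw_neq (a b c : nat) : cw a b c -> [/\ a != b, b != c & c != a].
Proof. by rewrite /cw; split; lia. Qed.

Lemma cw_asym (a b c : nat) : cw a b c -> ~~ cw c b a.
Proof. cw_lia. Qed.

(** * Crossings, maximality and successors in pointwise form *)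

Section Triangulations.

Variable N : nat.
Implicit Types (T U : {set {set 'I_N}}) (V : {set 'I_N}) (a b c d : 'I_N).

(** Of the four ways to order the ends of both edges only two matter, because exchanging [a] with
    [b] and [c] with [d] together gives the same condition. *)
Lemma crossing2P a b c d :
  reflect (cw a c b /\ cw b d a \/ cw a d b /\ cw b c a)
          (crossing [set a; b] [set c; d]).
Proof.
apply: (iffP andP) => [[_]|].
  case/exists_inP=> x xab /exists_inP[y yab].
  case/exists_inP=> z zcd /exists_inP[t tcd].
  move: xab yab zcd tcd; rewrite !inE.
  by do 4 ![case/orP=> /eqP->]; cw_lia.
move=> H; split.
  rewrite disjoints_subset; apply/subsetP=> x; rewrite !inE -!val_eqE /=.
  by move: H; cw_lia.
case: H => [H|H]; apply/exists_inP; exists a; rewrite ?set21 //;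
    apply/exists_inP; exists b; rewrite ?set22 //.
  apply/exists_inP; exists c; rewrite ?set21 //.
  by apply/exists_inP; exists d; rewrite ?set22 //; apply/andP.
apply/exists_inP; exists d; rewrite ?set22 //.
by apply/exists_inP; exists c; rewrite ?set21 //; apply/andP.
Qed.

Lemma edge_pair T e V : T \subset edges V -> e \in T ->
  exists a b, a != b /\ e = [set a; b].
Proof.
by move=> /subsetP sT /sT; rewrite inE => /andP[_ /cards2P].
Qed.

(** Maximality becomes the right to add any pair that crosses nothing in [T]. One orientation of [c]
    and [d] is enough, since [[set c; d]] can be read in both orders. *)
Lemma triangulationP T :
  reflect [/\ T \subset edges [set: 'I_N],
    (forall a b c d, [set a; b] \in T -> [set c; d] \in T ->
       cw a c b -> ~~ cw b d a) &
    (forall a b, a != b ->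
       (forall c d, [set c; d] \in T -> cw a c b -> ~~ cw b d a) ->
       [set a; b] \in T)]
  (triangulation [set: 'I_N] T).
Proof.
have nc2 S a b c d : noncrossing S -> [set a; b] \in S -> [set c; d] \in S ->
    cw a c b -> ~~ cw b d a.
  move=> /forall_inP ncS abS cdS acb; apply/negP=> bda.
  have /forall_inP/(_ _ cdS)/negP[] := ncS _ abS.
  by apply/crossing2P; left.
apply: (iffP maxsetP) => [[/andP[sT ncT] maxT]|[sT ncT maxT]].
  split=> // [a b c d|a b ab Hab]; first exact: nc2.
  pose S := [set a; b] |: T.
  suff <- : S = T by rewrite setU11.
  apply: maxT; last exact: subsetUr.
  rewrite subUset sT andbT sub1set inE subsetT cards2 ab /=.
  have abT f : f \in T -> ~~ crossing [set a; b] f.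
    move=> fT; have [c [d [_ def_f]]] := edge_pair sT fT.
    rewrite def_f in fT *; apply/negP=> /crossing2P[] [H1 H2].
      by have := Hab c d fT H1; rewrite H2.
    by rewrite setUC in fT; have := Hab d c fT H1; rewrite H2.
  have csym e f : crossing e f -> crossing f e.
    case/andP=> dis /exists_inP[x xe /exists_inP[y ye]].
    case/exists_inP=> z zf /exists_inP[t tf Hc]; rewrite /crossing disjoint_sym dis /=.
    apply/exists_inP; exists z => //; apply/exists_inP; exists t => //.
    apply/exists_inP; exists y => //; apply/exists_inP; exists x => //.
    by move: Hc; cw_lia.
  apply/forall_inP=> e /setU1P eS; apply/forall_inP=> f /setU1P fS.
  case: eS fS => [->|eT] [->|fT].
  - by apply/crossing2P; cw_lia.
  - exact: abT.
  - by apply/negP=> /csym; apply/negP/abT.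
  - by move/forall_inP: ncT => /(_ e eT)/forall_inP/(_ f fT).
split=> [|S /andP[sS ncS] TS].
  rewrite sT; apply/forall_inP=> e eT; apply/forall_inP=> f fT.
  have [a [b [_ def_e]]] := edge_pair sT eT.
  have [c [d [_ def_f]]] := edge_pair sT fT.
  rewrite def_e def_f in eT fT *; apply/negP=> /crossing2P[] [H1 H2].
    by have := ncT _ _ _ _ eT fT H1; rewrite H2.
  by rewrite (setUC [set c]) in fT; have := ncT _ _ _ _ eT fT H1; rewrite H2.
apply/eqP; rewrite eqEsubset TS andbT; apply/subsetP=> e eS.
have [a [b [ab def_e]]] := edge_pair sS eS; rewrite def_e in eS *.
apply: maxT => // c d cdT; apply: nc2 ncS eS _.
exact: (subsetP TS).
Qed.

(** The enumeration of [V] is increasing, so [next] gives the following element, or the first one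
    after the last. If this were not [b], it would lie strictly between [a] and [b]. *)
Lemma succ_eq V a b : a \in V -> b \in V -> a != b ->
  (forall c, c \in V -> ~~ cw a c b) -> succ V a = b.
Proof.
move=> aV bV ab Hc.
have srt : sorted ltn (map val (enum V)).
  rewrite -[enum _](eq_filter (mem_enum _)) -(eq_filter (mem_map val_inj _)).
  rewrite -filter_map (sorted_filter ltn_trans) //.
  by rewrite unlock val_ord_enum iota_ltn_sorted.
have lt_nth x y : x \in V -> y \in V -> index x (enum V) < index y (enum V) -> x < y.
  rewrite -!(mem_enum V) => xV yV ltxy.
  apply: (sorted_ltn_index ltn_trans srt); rewrite ?map_f //.
  by rewrite !(index_map val_inj).
have nthV i : i < size (enum V) -> nth a (enum V) i \in V.
  by rewrite -[_ \in V]mem_enum; apply: mem_nth.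
have := index_mem a (enum V); rewrite mem_enum aV => ia.
have := index_mem b (enum V); rewrite mem_enum bV => ib.
have idxa i : i < size (enum V) -> index (nth a (enum V) i) (enum V) = i.
  by move=> lti; rewrite index_uniq ?enum_uniq.
have iab : index a (enum V) != index b (enum V).
  by apply: contra ab => /eqP/(index_inj _)->; rewrite ?mem_enum.
have nthb : nth a (enum V) (index b (enum V)) = b by rewrite nth_index ?mem_enum.
rewrite /succ next_nth mem_enum aV.
have [lt_a|ge_a] := ltnP (index a (enum V)).+1 (size (enum V)).
  have -> : (if enum V is y :: p' then nth y p' (index a (enum V)) else a)
      = nth a (enum V) (index a (enum V)).+1.
    case: (enum V) lt_a => //= y s; rewrite ltnS => lt_s.
    exact: set_nth_default.
  have /negP nc := Hc _ (nthV _ lt_a).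
  set c := nth _ _ _ in nc *; have cV : c \in V by apply: nthV.
  have ic : index c (enum V) = (index a (enum V)).+1 by apply: idxa.
  have ac : a < c by apply: lt_nth; rewrite ?ic.
  have [lt_ab|lt_ba|eq_ab] := ltngtP (index a (enum V)) (index b (enum V)).
  - move: lt_ab; rewrite leq_eqVlt => /predU1P[eqb|ltb]; first by rewrite /c eqb.
    by case: nc; rewrite /cw ac (lt_nth c b) // ic.
  - by case: nc; rewrite /cw ac (lt_nth b a) ?orbT.
  - by rewrite eq_ab eqxx in iab.
(* Here [a] is the last element, and its successor wraps around to the first one. *)
have lt0 : 0 < size (enum V) by apply: leq_ltn_trans ia.
have -> : (if enum V is y :: p' then nth y p' (index a (enum V)) else a)
      = nth a (enum V) 0.
  by case: (enum V) ge_a => //= y s le_s; rewrite nth_default.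
have /negP nc := Hc _ (nthV _ lt0).
have [b0|b_gt0] := posnP (index b (enum V)); first by rewrite -b0.
case: nc; rewrite /cw (lt_nth (nth a (enum V) 0) b) ?nthV ?idxa //.
by rewrite (lt_nth b a) ?orbT // ltn_neqAle eq_sym iab -ltnS (leq_trans ib).
Qed.

End Triangulations.

Lemma set2_inj (X : finType) (a b c d : X) : [set a; b] = [set c; d] ->
  a = c /\ b = d \/ a = d /\ b = c.
Proof.
move=> E; have := set22 c d; have := set21 c d; rewrite -E !inE.
have := set22 a b; have := set21 a b; rewrite E !inE.
by do 4 case/orP=> /eqP ?; subst; auto.
Qed.

(** * Flips seen through their quadrilaterals *)

Section FullPolygon.

Variable N : nat.
Implicit Types (T U : {set {set 'I_N}}) (V : {set 'I_N}) (a b c d : 'I_N).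

Lemma val_succT a : 1 < N ->
  succ [set: 'I_N] a = (if a.+1 == N then 0 else a.+1) :> nat.
Proof.
move=> N_gt1.
have lt_s : (if a.+1 == N then 0 else a.+1) < N.
  by case: eqP (ltn_ord a) => /=; lia.
rewrite (@succ_eq _ _ a (Ordinal lt_s)) ?inE //.
  by rewrite -val_eqE /=; case: (a.+1 =P N); lia.
by move=> c _; rewrite /cw /=; case: (a.+1 =P N) (ltn_ord c) (ltn_ord a); lia.
Qed.

(** A vertex on each side of the chord keeps its ends from being consecutive. This rebuilds the
    interior-edge clause of [flip] in [flipP]. *)
Lemma boundary_cw a b c d : cw a b c -> cw c d a ->
  [set a; c] \notin boundary [set: 'I_N].
Proof.
move=> abc cda; apply/negP=> /imsetP[x _ /set2_inj E].
have N_gt1 : 1 < N by have [] := cw_neq abc; case: (a) (b) => i ? [] j ? /=; lia.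
have := val_succT x N_gt1; set y := succ _ _ in E * => Ey.
move: abc cda (ltn_ord a) (ltn_ord b) (ltn_ord c) (ltn_ord d).
by case: E Ey => [] [-> ->] ->; rewrite /cw; case: (x.+1 =P N); lia.
Qed.

Lemma pair_neq T a b : T \subset edges [set: 'I_N] -> [set a; b] \in T -> a != b.
Proof.
move=> /subsetP sT /sT; rewrite inE => /andP[_ /eqP c2]; apply/eqP=> E.
by rewrite E setUid cards1 in c2.
Qed.

Definition quad_flip T T' a b c d :=
  [/\ cw a b c /\ cw c d a, [set a; c] \in T,
      [set a; b] \in T /\ [set b; c] \in T,
      [set c; d] \in T /\ [set d; a] \in T &
      T' = [set b; d] |: (T :\ [set a; c])].

Lemma flipP T T' :
  reflect [/\ triangulation [set: 'I_N] T, triangulation [set: 'I_N] T' &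
             exists a b c d, quad_flip T T' a b c d]
          (flip [set: 'I_N] T T').
Proof.
apply: (iffP and3P) => [] [triT triT' H]; split=> //.
  case/existsP: H => a /existsP[b /existsP[c /existsP[d]]].
  case/and5P=> abc cda /setDP[acT _] abT /and4P[bcT cdT daT /eqP ->].
  by exists a, b, c, d.
case: H => a [b [c [d [[abc cda] acT [abT bcT] [cdT daT] ->]]]].
apply/existsP; exists a; apply/existsP; exists b.
apply/existsP; exists c; apply/existsP; exists d.
by rewrite abc cda abT bcT cdT daT eqxx inE acT (boundary_cw abc cda).
Qed.

(** The new diagonal crosses the old one, hence was not in [T], and removing it from [T'] gives back
    [T] minus the old diagonal. The sides differ from both diagonals, so they stay. *)
Lemma quad_flip_sym T T' a b c d : triangulation [set: 'I_N] T ->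
  quad_flip T T' a b c d -> quad_flip T' T b c d a.
Proof.
case/triangulationP=> sT ncT _ [[abc cda] acT [abT bcT] [cdT daT] ->].
have bdT : [set b; d] \notin T.
  by apply/negP=> bdT; have := ncT _ _ _ _ acT bdT abc; rewrite cda.
have ne1 x y : [set x; y] \in T -> (x == b) || (x == d) || (y == b) || (y == d) ->
    [set x; y] \in [set b; d] |: (T :\ [set a; c]).
  move=> xyT bd; rewrite !inE xyT andbT; apply/orP; right; apply/eqP=> /set2_inj E.
  move: bd (cw_neq abc) (cw_neq cda) => H [] /eqP ? /eqP ? /eqP ? [] /eqP ? /eqP ? /eqP ?.
  case: E H => [] [-> ->]; rewrite -!orbA -!val_eqE /=.
    by case/or4P=> /eqP ?; congruence.
  by case/or4P=> /eqP ?; congruence.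
split; rewrite ?setU11 //.
- by move: abc cda; cw_lia.
- by split; apply: ne1; rewrite ?eqxx ?orbT.
- by split; apply: ne1; rewrite ?eqxx ?orbT.
apply/setP=> e; rewrite !inE (setUC [set c]); case: eqP => [->|] //=.
by case: eqP => [->|] //=; rewrite (negPf bdT).
Qed.

Lemma quad_flip_rot T T' a b c d :
  quad_flip T T' a b c d -> quad_flip T T' c d a b.
Proof.
case=> [[abc cda] acT [abT bcT] [cdT daT] ->]; split=> //.
  by rewrite setUC.
by rewrite (setUC [set d]) (setUC [set c]).
Qed.

Lemma flip_sym : symmetric (@flip N [set: 'I_N]).
Proof.
suff S T T' : flip [set: 'I_N] T T' -> flip [set: 'I_N] T' T.
  by move=> T T'; apply/idP/idP; apply: S.
case/flipP=> triT triT' [a [b [c [d q]]]]; apply/flipP; split=> //.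
by exists b, c, d, a; apply: quad_flip_sym.
Qed.

(** Stated by betweenness, so that it is symmetric and feeds [cw] directly. It also holds when
    [p = q], which is why distinctness is asked for separately. *)
Definition adjacent (p q : 'I_N) :=
  (forall z : 'I_N, ~~ cw p z q) \/ (forall z : 'I_N, ~~ cw q z p).

(** Otherwise [y], next to [a], lies strictly beyond the side [[set a; b]] or [[set d; a]], and
    [[set y; c]] crosses that side. *)
Lemma quad_vertex T T' a b c d y : triangulation [set: 'I_N] T ->
  quad_flip T T' a b c d -> y != a -> adjacent a y -> [set y; c] \in T ->
  y = b \/ y = d.
Proof.
case/triangulationP=> sT ncT _ [[abc cda] acT [abT bcT] [cdT daT] _] ya adj ycT.
case: (eqVneq y b) => [|yb]; first by left.
case: (eqVneq y d) => [|yd]; first by right.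
rewrite -!val_eqE /= in ya yb yd.
case: adj => adj.
  have ayb : cw a y b by move: (adj b) ya yb abc; cw_lia.
  by have := ncT _ _ _ _ abT ycT ayb; move: abc; cw_lia.
have dya : cw d y a by move: (adj d) ya yd cda; cw_lia.
by have := ncT _ _ _ _ daT ycT dya; move: cda; cw_lia.
Qed.

Lemma adjacentC p q : adjacent p q -> adjacent q p.
Proof. by case; [right|left]. Qed.

(* A diagonal replaced by a flip is not the side of a triangle on an edge of  *)
(* the boundary, unless that edge is a side of the quadrilateral.              *)
Lemma quad_link_sub T T' a b c d p q x : triangulation [set: 'I_N] T ->
  quad_flip T T' a b c d -> adjacent p q -> p != q ->
  ~~ ((p \in [set a; b; c; d]) && (q \in [set a; b; c; d])) ->
  [set p; x] \in T -> [set q; x] \in T -> [set p; x] \in T'.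
Proof.
move=> triT qf adj pq nq pxT qxT.
have [_ _ _ _ ->] := qf; rewrite !inE pxT andbT; apply/orP; right.
apply/eqP=> /set2_inj[] [E1 E2]; subst.
  case: (quad_vertex triT qf _ adj qxT); first by rewrite eq_sym.
    by move=> Eq; rewrite Eq !inE !eqxx ?orbT in nq.
  by move=> Eq; rewrite Eq !inE !eqxx ?orbT in nq.
case: (quad_vertex triT (quad_flip_rot qf) _ adj qxT); first by rewrite eq_sym.
  by move=> Eq; rewrite Eq !inE !eqxx ?orbT in nq.
by move=> Eq; rewrite Eq !inE !eqxx ?orbT in nq.
Qed.

(** Used as its contrapositive: an incident flip has both ends of the boundary edge among its
    corners. The two triangulations have the same triangle on that edge by [quad_link_sub], applied
    to the flip and to its inverse. *)
Lemma quad_flip_link T T' a b c d p : 1 < N -> triangulation [set: 'I_N] T ->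
  triangulation [set: 'I_N] T' -> quad_flip T T' a b c d ->
  ~~ ((p \in [set a; b; c; d]) && (succ [set: 'I_N] p \in [set a; b; c; d])) ->
  link [set: 'I_N] T p = link [set: 'I_N] T' p.
Proof.
move=> N_gt1 triT triT' qf nq; set q := succ _ p in nq *.
have Eq := val_succT p N_gt1; rewrite -/q in Eq.
have pq : p != q by rewrite -val_eqE /= Eq; case: (p.+1 =P N) (ltn_ord p); lia.
have adj : adjacent p q.
  left=> z; rewrite /cw Eq; case: (p.+1 =P N) (ltn_ord p) (ltn_ord z); lia.
have qf' := quad_flip_sym triT qf.
have nq' : ~~ ((p \in [set b; c; d; a]) && (q \in [set b; c; d; a])).
  suff -> : [set b; c; d; a] = [set a; b; c; d] by [].
  by apply/setP=> z; rewrite !inE; do 4 case: (z == _).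
have nqC : ~~ ((q \in [set a; b; c; d]) && (p \in [set a; b; c; d])) by rewrite andbC.
have nqC' : ~~ ((q \in [set b; c; d; a]) && (p \in [set b; c; d; a])) by rewrite andbC.
have qp : q != p by rewrite eq_sym.
have adjC := adjacentC adj.
apply: eq_pick => x /=; apply/andP/andP => [] [pxT qxT]; split.
- exact: quad_link_sub triT qf adj pq nq pxT qxT.
- exact: quad_link_sub triT qf adjC qp nqC qxT pxT.
- exact: quad_link_sub triT' qf' adj pq nq' pxT qxT.
- exact: quad_link_sub triT' qf' adjC qp nqC' qxT pxT.
Qed.

Lemma triangulation_cross T a b : triangulation [set: 'I_N] T -> a != b ->
  [set a; b] \notin T -> exists c d, [/\ [set c; d] \in T, cw a c b & cw b d a].
Proof.
case/triangulationP=> _ _ maxT ab abT.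
have [/existsP[c /existsP[d /and3P[]]]|] := boolP [exists c, exists d : 'I_N,
  [&& [set c; d] \in T, cw a c b & cw b d a]]; first by exists c, d.
rewrite negb_exists => /forallP H; case/negP: abT; apply: maxT => // c d cdT acb.
by have:= H c; rewrite negb_exists => /forallP/(_ d); rewrite cdT acb.
Qed.

End FullPolygon.

(** * Contraction of a boundary edge, for triangulations, flips and paths *)

Section Collapse.

Variables (n m : nat) (f : 'I_n -> 'I_m).
Implicit Types (T : {set {set 'I_n}}).

(** The cardinality test drops the edges shrunk to a point. Deletion of a vertex, relabeling and the
    reflected contraction are all instances, which makes them composable. *)
Definition collapse T : {set {set 'I_m}} :=
  [set f @: (e : {set 'I_n}) | e in T & #|f @: e| == 2].

Lemma imset_set2 (x y : 'I_n) : f @: [set x; y] = [set f x; f y].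
Proof. by rewrite imsetU !imset_set1. Qed.

Lemma collapse_edges T : collapse T \subset edges [set: 'I_m].
Proof.
by apply/subsetP=> e /imsetP[e0]; rewrite inE => /andP[_ c2] ->; rewrite inE subsetT.
Qed.

Lemma collapse2P T (u v : 'I_m) : T \subset edges [set: 'I_n] ->
  reflect (exists x y, [/\ [set x; y] \in T, f x = u, f y = v & u != v])
          ([set u; v] \in collapse T).
Proof.
move=> sT; apply: (iffP imsetP) => [[e]|[x [y [xyT <- <- uv]]]].
  rewrite inE => /andP[eT c2] E; have [x [y [xy def_e]]] := edge_pair sT eT.
  have uv : u != v.
    by apply/eqP=> uv; rewrite -E uv setUid cards1 in c2.
  rewrite def_e imset_set2 in E eT; have [[Eu Ev]|[Eu Ev]] := set2_inj E.
    by exists x, y.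
  by exists y, x; rewrite setUC; split.
exists [set x; y]; last by rewrite imset_set2.
by rewrite inE xyT imset_set2 cards2 uv.
Qed.

Variables p q : 'I_n.
(** Orientation is reversed because [f] will include a reflection. Going from images to preimages
    leaves room for the merging of [p] and [q]. *)
Hypothesis f_cw : forall a b c, cw (f a) (f b) (f c) -> cw c b a.
Hypothesis f_pq : f p = f q.
Hypothesis f_inj : forall x y, f x = f y -> x != y ->
  x = p /\ y = q \/ x = q /\ y = p.
Hypothesis f_surj : forall u, exists x, f x = u.
Hypothesis pq : forall z : 'I_n, ~~ cw p z q.
Hypothesis neq_pq : p != q.

Lemma collapse_cw (a b c : 'I_n) : cw c b a -> f a != f b -> f b != f c -> f c != f a ->
  cw (f a) (f b) (f c).
Proof.
move=> cba; rewrite -!val_eqE /= => ab bc ca.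
case/orP: (cw_total ab bc ca) => // /f_cw abc.
by have := cw_asym cba; rewrite abc.
Qed.

(** Crossing images come from crossing edges. For maximality, a pair that crosses no image is
    lifted: away from the merged vertex its lift crosses nothing in [T], and at the merged vertex
    one of its two lifts is in [T]. *)
Lemma collapse_triangulation T : triangulation [set: 'I_n] T ->
  triangulation [set: 'I_m] (collapse T).
Proof.
move=> triT; have [sT ncT maxT] := triangulationP T triT.
have memc x y : [set x; y] \in T -> f x != f y -> [set f x; f y] \in collapse T.
  by move=> xyT fxy; apply/(collapse2P _ _ sT); exists x, y.
apply/triangulationP; split; first exact: collapse_edges.
  move=> a b c d /(collapse2P _ _ sT)[x [y [xyT <- <- _]]].
  case/(collapse2P _ _ sT)=> z [t [ztT <- <- _]] /f_cw yzx.
  apply/negP=> /f_cw xty; rewrite setUC in ztT.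
  by have := ncT _ _ _ _ xyT ztT xty; rewrite yzx.
move=> u v uv Huv.
(* An edge of [T] that crosses a lift of [[set u; v]] shares an image vertex with it; otherwise the
   images would cross, against [Huv]. *)
have Hcross x y s t : f x = u -> f y = v -> [set s; t] \in T ->
    cw x s y -> cw y t x -> [|| f s == u, f s == v, f t == u | f t == v].
  move=> fx fy stT xsy ytx; apply/negPn/negP; rewrite !negb_or.
  case/and4P=> fsu fsv ftu ftv.
  have fst : f s != f t.
    apply/eqP=> fst; have [|[E1 E2]|[E1 E2]] := f_inj fst.
    - by rewrite -val_eqE /=; move: xsy ytx; cw_lia.
    - by move: (pq y) xsy ytx; rewrite E1 E2; cw_lia.
    - by move: (pq x) xsy ytx; rewrite E1 E2; cw_lia.
  have := Huv (f t) (f s); rewrite setUC; move/(_ (memc _ _ stT fst)).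
  rewrite -fx -fy in fsu fsv ftu ftv uv *.
  have -> : cw (f x) (f t) (f y) by apply: collapse_cw => //; rewrite eq_sym.
  have -> : cw (f y) (f s) (f x) by apply: collapse_cw => //; rewrite eq_sym.
  by move/(_ isT).
have [[x fx] [y fy]] := (f_surj u, f_surj v).
(* If neither lift is in [T], an edge blocking [[set p; y']] must end at [q] and one blocking
   [[set q; y']] must end at [p]. These two blocking edges cross each other. *)
have Hp u' v' y' : u' != v' -> f p = u' -> f y' = v' ->
    (forall x s t, f x = u' -> [set s; t] \in T ->
      cw x s y' -> cw y' t x -> [|| f s == u', f s == v', f t == u' | f t == v']) ->
    [set u'; v'] \in collapse T.
  move=> uv' fp fy' H; have fq : f q = u' by rewrite -f_pq.
  have py : p != y' by apply: contra uv' => /eqP py; rewrite -fp -fy' py.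
  have qy : q != y' by apply: contra uv' => /eqP qy; rewrite -fq -fy' qy.
  have fib z : f z = u' -> z = p \/ z = q.
    rewrite -fp; case: (eqVneq z p) => [->|zp fz]; first by left.
    by case: (f_inj fz zp) => [] [-> _]; auto.
  have fib' z : f z = v' -> z = y'.
    rewrite -fy'; case: (eqVneq z y') => // zy fz.
    case: (f_inj fz zy) => [] [_ E]; first by rewrite E eqxx in qy.
    by rewrite E eqxx in py.
  have [pyT|pyT] := boolP ([set p; y'] \in T).
    by rewrite -fp -fy' memc // fp fy'.
  have [qyT|qyT] := boolP ([set q; y'] \in T).
    by rewrite -fq -fy' memc // fq fy'.
  have [s [t [stT psy ytp]]] := triangulation_cross triT py pyT.
  have [s' [t' [stT' qsy ytq]]] := triangulation_cross triT qy qyT.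
  have sq : s = q.
    have /or4P[] := H _ _ _ fp stT psy ytp => /eqP.
    - by case/fib=> // E; move: psy; rewrite E; cw_lia.
    - by move/fib'=> E; move: psy; rewrite E; cw_lia.
    - case/fib=> E; first by move: ytp; rewrite E; cw_lia.
      by move: ytp (pq y'); rewrite E; cw_lia.
    - by move/fib'=> E; move: ytp; rewrite E; cw_lia.
  have tp' : t' = p.
    have /or4P[] := H _ _ _ fq stT' qsy ytq => /eqP.
    - case/fib=> E; last by move: qsy; rewrite E; cw_lia.
      by move: qsy (pq y'); rewrite E; cw_lia.
    - by move/fib'=> E; move: qsy; rewrite E; cw_lia.
    - by case/fib=> // E; move: ytq; rewrite E; cw_lia.
    - by move/fib'=> E; move: ytq; rewrite E; cw_lia.
  rewrite sq in stT; rewrite tp' setUC in stT'.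
  have pqs : cw p q s'.
    by move: qsy (pq s') neq_pq; rewrite -val_eqE /=  tp' in ytq *; move: ytq; cw_lia.
  have := ncT _ _ _ _ stT' stT pqs.
  by move: ytp qsy psy ytq; rewrite sq tp'; cw_lia.
have [xp|xp] := boolP (f x == f p).
  apply: (Hp _ _ y uv) => //; first by rewrite -(eqP xp).
  by move=> x' s t fx' stT; apply: Hcross.
have [yp|yp] := boolP (f y == f p).
  rewrite setUC; apply: (Hp _ _ x) => //; rewrite 1?eq_sym //.
    by rewrite -(eqP yp).
  move=> y' s t fy' stT ysx xty; rewrite setUC in stT.
  by have := Hcross _ _ _ _ fx fy' stT xty ysx; case/or4P=> ->; rewrite ?orbT.
have fib z t : f z != f p -> f t = f z -> t = z.
  move=> zp ft; case: (eqVneq t z) => // tz.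
  by case: (f_inj ft tz) => [] [_ E]; rewrite E ?f_pq eqxx in zp.
rewrite -fx -fy memc ?fx ?fy // ; apply: maxT => [|s t stT xsy].
  by apply: contra uv => /eqP E; rewrite -fx -fy E.
apply/negP=> ytx; have := Hcross _ _ _ _ fx fy stT xsy ytx.
rewrite -fx -fy; case/or4P=> /eqP/fib E; move: xsy ytx; rewrite ?E //; cw_lia.
Qed.

(** When two consecutive corners merge, the lost diagonal has the same image as one of the sides. *)
Lemma collapse_sub T T' a b c d : T \subset edges [set: 'I_n] ->
  T' \subset edges [set: 'I_n] ->
  (forall e, e \in T -> e != [set a; c] -> e \in T') ->
  [set a; b] \in T' -> [set b; c] \in T' -> [set c; d] \in T' ->
  [set d; a] \in T' ->
  [|| f a == f b, f b == f c, f c == f d | f d == f a] ->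
  collapse T \subset collapse T'.
Proof.
move=> sT sT' sub abT bcT cdT daT E; apply/subsetP=> e eT.
have [u [v [uv def_e]]] := edge_pair (collapse_edges T) eT.
rewrite def_e in eT *; case/(collapse2P _ _ sT): eT => x [y [xyT fx fy _]].
have [/eqP exy|nxy] := boolP ([set x; y] == [set a; c]); last first.
  by apply/(collapse2P _ _ sT'); exists x, y; split=> //; apply: sub.
have -> : [set u; v] = [set f a; f c] by rewrite -fx -fy -!imset_set2 exy.
have fac : f a != f c.
  by rewrite -fx -fy in uv; case: (set2_inj exy) => [] [<- <-]; rewrite // eq_sym.
apply/(collapse2P _ _ sT'); case/or4P: E => /eqP E.
- by exists b, c.
- by exists a, b.
- by exists a, d; rewrite setUC.
- by exists d, c; rewrite setUC.
Qed.

(** Since no vertex separates [p] from [q], they are not opposite corners: they bound a side, which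
    is collapsed. *)
Lemma quad_collapse_eq T T' a b c d : triangulation [set: 'I_n] T ->
  triangulation [set: 'I_n] T' -> quad_flip T T' a b c d ->
  p \in [set a; b; c; d] -> q \in [set a; b; c; d] -> collapse T = collapse T'.
Proof.
move=> triT triT' qf pin qin.
have [sT _ _] := triangulationP T triT; have [sT' _ _] := triangulationP T' triT'.
have qf' := quad_flip_sym triT qf.
have [[abc cda] acT [abT bcT] [cdT daT] E] := qf.
have [_ bdT' [bcT' cdT'] [daT' abT'] E'] := qf'.
have H : [|| f a == f b, f b == f c, f c == f d | f d == f a].
  move: pin qin neq_pq (pq a) (pq b) (pq c) (pq d) abc cda f_pq.
  rewrite !inE -!orbA.
  case/or4P=> /eqP-> /or4P[] /eqP-> //; rewrite ?eqxx // => _;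
    do ?[by move=> *; apply/or4P; constructor; apply/eqP];
    by cw_lia.
apply/eqP; rewrite eqEsubset (@collapse_sub T T' a b c d) //=.
  apply: (@collapse_sub T' T b c d a) => // [e eT' ne|].
    by rewrite E' !inE ne eT' orbT.
  by move: H; case/or4P=> ->; rewrite ?orbT.
by move=> e eT ne; rewrite E !inE ne eT orbT.
Qed.

Lemma quad_collapse_flip T T' a b c d : triangulation [set: 'I_n] T ->
  triangulation [set: 'I_n] T' -> quad_flip T T' a b c d ->
  ~~ ((p \in [set a; b; c; d]) && (q \in [set a; b; c; d])) ->
  flip [set: 'I_m] (collapse T) (collapse T').
Proof.
move=> triT triT' qf nq.
have [sT _ _] := triangulationP T triT; have [sT' _ _] := triangulationP T' triT'.
have [[abc cda] acT [abT bcT] [cdT daT] E] := qf.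
have bdT' : [set b; d] \in T' by rewrite E setU11.
have finj x y : x \in [set a; b; c; d] -> y \in [set a; b; c; d] -> x != y ->
    f x != f y.
  move=> xin yin xy; apply/eqP=> fxy.
  by case: (f_inj fxy xy) => [] [Ex Ey]; rewrite -Ex -Ey xin yin in nq.
have qd : [/\ a \in [set a; b; c; d], b \in [set a; b; c; d], c \in [set a; b; c; d]
   & d \in [set a; b; c; d]] by rewrite !inE !eqxx !orbT.
have [ain bin cin din] := qd.
have [[ab bc ca] [cd da ac]] := (cw_neq abc, cw_neq cda).
have bd : b != d by rewrite -val_eqE /=; move: abc cda; cw_lia.
have memc x y : [set x; y] \in T -> x \in [set a; b; c; d] ->
    y \in [set a; b; c; d] -> [set f x; f y] \in collapse T.
  move=> xyT xin yin; apply/(collapse2P _ _ sT); exists x, y; split=> //.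
  by apply: finj => //; apply: pair_neq xyT.
apply/flipP; split; try exact: collapse_triangulation.
(* The corners are listed backwards because [f] reverses orientation. *)
exists (f a), (f d), (f c), (f b).
have adjpq : adjacent p q by left.
(* Only the old diagonal lies over its image, so removing it commutes with the collapse. An edge
   with one end moved to the merged twin would, by [quad_vertex], put that twin at a neighbouring
   corner, where [f] is injective. *)
have key x y : [set x; y] \in T -> f x = f a -> f y = f c -> [set x; y] = [set a; c].
  move=> xyT fx fy.
  case: (eqVneq x a) xyT => [->|xa] xyT.
    case: (eqVneq y c) xyT => [-> //|yc] xyT.
    have adj : adjacent c y.
      by case: (f_inj fy yc) => [] [-> ->] //; apply: adjacentC.
    rewrite setUC in xyT.
    have yin := quad_vertex triT (quad_flip_rot qf) yc adj xyT.
    have := finj y c; rewrite fy eqxx cin yc.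
    by case: yin => ->; rewrite ?din ?bin => /(_ isT isT isT).
  have adj : adjacent a x.
    by case: (f_inj fx xa) => [] [-> ->] //; apply: adjacentC.
  case: (eqVneq y c) xyT => [->|yc] xyT.
    have xin := quad_vertex triT qf xa adj xyT.
    have := finj x a; rewrite fx eqxx ain xa.
    by case: xin => ->; rewrite ?din ?bin => /(_ isT isT isT).
  case: (f_inj fx xa) (f_inj fy yc) => [] [-> Ea] [] [-> Ec].
  - by rewrite Ea Ec eqxx in ca.
  - by rewrite Ea Ec setUC.
  - by rewrite Ea Ec setUC.
  - by rewrite Ea Ec eqxx in ca.
split.
- by split; apply: collapse_cw => //; apply: finj; rewrite // -?val_eqE //= eq_sym.
- exact: memc.
- by split; rewrite setUC; apply: memc.
- by split; rewrite setUC; apply: memc.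
apply/eqP; rewrite eqEsubset; apply/andP; split; apply/subsetP=> e.
  move=> eT'; have [u [v [uv def_e]]] := edge_pair (collapse_edges _) eT'.
  rewrite def_e in eT' *; case/(collapse2P _ _ sT'): eT' => x [y [xyT' fx fy _]].
  move: xyT'; rewrite E => /setU1P[exy|].
    by apply/setU1P; left; rewrite -fx -fy -imset_set2 exy imset_set2 setUC.
  case/setD1P=> ne xyT; apply/setU1P; right; apply/setD1P; split.
    apply: contra ne => /eqP Euv; apply/eqP.
    case: (set2_inj Euv) => [] [Eu Ev]; rewrite -fx -fy in Eu Ev.
      exact: key.
    by rewrite setUC; apply: key => //; rewrite setUC.
  by apply/(collapse2P _ _ sT); exists x, y.
case/setU1P=> [->|/setD1P[ne eT]].
  by rewrite setUC; apply/(collapse2P _ _ sT'); exists b, d; split=> //; apply: finj.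
have [u [v [uv def_e]]] := edge_pair (collapse_edges _) eT.
rewrite def_e in eT ne *; case/(collapse2P _ _ sT): eT => x [y [xyT fx fy _]].
apply/(collapse2P _ _ sT'); exists x, y; split=> //.
rewrite E !inE xyT andbT; apply/orP; right.
by apply: contra ne => /eqP Exy; rewrite -fx -fy -!imset_set2 Exy.
Qed.

(** A flip with [p] and [q] among its corners vanishes and counts for at most one incidence. Any
    other flip survives and counts for none. *)
Lemma collapse_path T s : 1 < n -> q = succ [set: 'I_n] p ->
  path (flip [set: 'I_n]) T s ->
  exists s', [/\ path (flip [set: 'I_m]) (collapse T) s',
    last (collapse T) s' = collapse (last T s) &
    size s' + nb_incident [set: 'I_n] p T s <= size s].
Proof.
move=> n_gt1 def_q; elim: s T => [|T' s IHs] T /=; first by exists [::].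
case/andP=> fl /IHs[s' [ps' ls' sz]].
have [triT triT' [a [b [c [d qf]]]]] := flipP _ _ fl.
have [/andP[pin qin]|nq] := boolP ((p \in [set a; b; c; d]) && (q \in [set a; b; c; d])).
  rewrite (quad_collapse_eq triT triT' qf pin qin); exists s'; split=> //.
  rewrite /nb_incident /= addnCA; rewrite /nb_incident in sz.
  by move: sz (leq_b1 (incident [set: 'I_n] p T T')); lia.
exists (collapse T' :: s'); split=> //=.
  by rewrite ps' (quad_collapse_flip triT triT' qf nq).
rewrite def_q in nq.
by rewrite /nb_incident /= /incident (quad_flip_link _ _ _ qf nq) // eqxx.
Qed.

End Collapse.

(** * Deletion and relabeling as collapses *)

Section Relabeling.

Variable N : nat.
Implicit Types (T : {set {set 'I_N}}) (V : {set 'I_N}).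

Definition contract V (a x : 'I_N) : 'I_N := if x == a then succ V a else x.

Lemma val_contract V a x :
  contract V a x = (if x == a :> nat then succ V a : nat else x) :> nat.
Proof. by rewrite /contract -val_eqE; case: eqP. Qed.

Lemma val_succ V (a : 'I_N) (b : nat) (ltb : b < N) : a \in V ->
  Ordinal ltb \in V -> a != b :> nat ->
  (forall c : 'I_N, c \in V -> ~~ cw a c b) -> succ V a = b :> nat.
Proof. by move=> aV bV ab H; rewrite (succ_eq aV bV). Qed.

(** The edge removed by [deletion] is precisely the one that [contract] shrinks to a point. *)
Lemma deletion_collapse V T a : T \subset edges [set: 'I_N] -> succ V a != a ->
  deletion V T a = collapse (contract V a) T.
Proof.
move=> sT sa; rewrite /deletion.
have eqc e : e \in T -> (#|contract V a @: e| == 2) = (e != [set a; succ V a]).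
  move=> eT; have [x [y [xy def_e]]] := edge_pair sT eT.
  rewrite def_e imset_set2 cards2 eqSS eqb1; congr (~~ _).
  rewrite /contract; apply/eqP/eqP => [|/set2_inj[] [-> ->]].
  - case: (x =P a) => [Ex|_]; case: (y =P a) => [Ey|_] E.
    + by rewrite Ex Ey eqxx in xy.
    + by rewrite Ex E.
    + by rewrite Ey E setUC.
    + by rewrite E eqxx in xy.
  - by rewrite eqxx (negPf sa).
  - by rewrite eqxx (negPf sa).
apply/setP=> e; apply/imsetP/imsetP=> [] [e0].
  by case/setD1P=> ne e0T ->; exists e0; rewrite // inE e0T eqc.
by rewrite inE => /andP[e0T]; rewrite eqc // => ne ->; exists e0; rewrite // !inE ne.
Qed.

Lemma collapse_comp m l (f : 'I_N -> 'I_m) (g : 'I_m -> 'I_l) T :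
  T \subset edges [set: 'I_N] ->
  collapse g (collapse f T) = collapse (g \o f) T.
Proof.
move=> sT; apply/setP=> e; apply/idP/idP=> eC.
  have [u [v [uv def_e]]] := edge_pair (collapse_edges g _) eC.
  move: eC; rewrite def_e => /(collapse2P _ _ _ (collapse_edges _ _)).
  case=> x [y [/(collapse2P _ _ _ sT)[x' [y' [xyT fx fy _]]] gx gy _]].
  by apply/(collapse2P _ _ _ sT); exists x', y'; rewrite /= fx fy.
have [u [v [uv def_e]]] := edge_pair (collapse_edges (g \o f) _) eC.
move: eC; rewrite def_e => /(collapse2P _ _ _ sT)[x [y [xyT gx gy _]]].
apply/(collapse2P _ _ _ (collapse_edges _ _)); exists (f x), (f y); split=> //.
apply/(collapse2P _ _ _ sT); exists x, y; split=> //.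
by apply: contra uv => /eqP E; rewrite -gx -gy /= E.
Qed.

Lemma relabel_collapse n V T (D : 'I_N -> 'I_N) (psi : 'I_N -> 'I_n) v c :
  T \subset edges [set: 'I_N] ->
  injective (@vertex_of_label N n V v c) ->
  (forall x, vertex_of_label V v c (psi x) = D x) ->
  relabel n V (collapse D T) v c = collapse psi T.
Proof.
move=> sT injL LD; apply/setP=> e; rewrite inE; apply/idP/idP=> eC.
  have /eqP : #|vertex_of_label V v c @: e| == 2.
    by move: (subsetP (collapse_edges D T) _ eC); rewrite inE => /andP[].
  rewrite card_imset // => /eqP/cards2P[i [j [ij def_e]]].
  move: eC; rewrite def_e imset_set2 => /(collapse2P _ _ _ sT)[x [y [xyT]]].
  rewrite -!LD => /injL Ei /injL Ej _.
  by apply/(collapse2P _ _ _ sT); exists x, y.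
have [i [j [ij def_e]]] := edge_pair (collapse_edges _ _) eC.
move: eC; rewrite def_e => /(collapse2P _ _ _ sT)[x [y [xyT Ei Ej _]]].
rewrite imset_set2; apply/(collapse2P _ _ _ sT); exists x, y.
by rewrite -!LD Ei Ej; split=> //; apply: contra ij => /eqP/injL->.
Qed.

(** Here [vert] lists the kept vertices clockwise from [v], and [rk x] is the position in this list
    of the vertex [D x] that absorbs [x]. The label is this position shifted by [c]. *)
Lemma relabel_rank n V T (D : 'I_N -> 'I_N) (psi : 'I_N -> 'I_n) v c
    (vert rk : nat -> nat) :
  T \subset edges [set: 'I_N] -> c <= n ->
  (forall r, r < n -> iter r (succ V) v = vert r :> nat) ->
  (forall r r', r < n -> r' < n -> vert r = vert r' -> r = r') ->
  (forall x : 'I_N, rk x < n) ->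
  (forall x : 'I_N, vert (rk x) = D x) ->
  (forall x : 'I_N, psi x = (c + rk x) %% n :> nat) ->
  relabel n V (collapse D T) v c = collapse psi T.
Proof.
move=> sT le_cn vertE vert_inj rk_lt rkE psiE.
apply: relabel_collapse => // [i j E|x].
  have n_gt0 : 0 < n by apply: leq_ltn_trans (ltn_ord i).
  have := congr1 val E; rewrite /= /vertex_of_label !vertE ?ltn_pmod // => {}E.
  have /eqP := vert_inj _ _ (ltn_pmod _ n_gt0) (ltn_pmod _ n_gt0) E.
  by rewrite eqn_modDr !modn_small // => /eqP/val_inj.
have n_gt0 : 0 < n by apply: leq_ltn_trans (rk_lt x).
apply: val_inj; rewrite /= /vertex_of_label vertE ?ltn_pmod //= psiE modnDml.
by rewrite addnAC subnKC // modnDl modn_small ?rkE.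
Qed.

Lemma iter_succ n V (v : 'I_N) (vert : nat -> nat) : v = vert 0 :> nat ->
  (forall r, r < n -> vert r < N) ->
  (forall r (x : 'I_N), r < n -> x = vert r :> nat -> x \in V) ->
  (forall r (x : 'I_N), r.+1 < n -> x \in V -> ~~ cw (vert r) x (vert r.+1)) ->
  (forall r, r.+1 < n -> vert r != vert r.+1) ->
  forall r, r < n -> iter r (succ V) v = vert r :> nat.
Proof.
move=> v0 vlt vV vcw vneq; elim=> [//|r IHr] lt_r /=.
have Er := IHr (ltnW lt_r).
apply: (@val_succ _ _ _ (vlt _ lt_r)).
- exact: (vV r _ (ltnW lt_r)).

- exact: (vV r.+1).
- by rewrite Er vneq.
- by move=> c cV; rewrite Er vcw.
Qed.

End Relabeling.

(** * Arithmetic description of the zigzag *)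

Section Zigzag.

Variable n : nat.
Hypothesis n_gt2 : 2 < n.
Local Notation N := n.+4.

Lemma val_natZ (z : nat) : (z%:R : 'I_N)%R = z %% N :> nat.
Proof. by rewrite Zp_nat. Qed.

Lemma val_addZ (a k : nat) : a + k < N -> (a%:R + k%:R : 'I_N)%R = a + k :> nat.
Proof. by move=> lt; rewrite -GRing.natrD val_natZ modn_small. Qed.

Lemma val_subZ (a k : nat) : a < N -> k < N ->
  (a%:R - k%:R : 'I_N)%R = (if k <= a then a - k else a + N - k) :> nat.
Proof.
move=> la lk; case: leqP => [le_ka|lt_ak].
  by rewrite -GRing.natrB // val_natZ modn_small //; lia.
have -> : (a%:R - k%:R : 'I_N)%R = ((a + N - k)%:R)%R.
  rewrite GRing.natrB; last by lia.
  have NZ : (N%:R : 'I_N)%R = 0%R by apply: val_inj; apply: etrans (val_natZ N) (modnn N).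
  by rewrite GRing.natrD NZ GRing.addr0.
by rewrite val_natZ modn_small //; lia.
Qed.

(* [zigzag_pair M s t]: {s, t} is one of the interior edges of Z_M, with      *)
(* t = 4 + k; the bounds on t say that the index of the edge is at most M - 3. *)
Definition zigzag_pair (M s t : nat) : bool :=
  (4 <= t) &&
  (((s + t == 6) || (s + t == M + 6)) && (t.*2 <= M + 4)
  || ((s + t == 5) || (s + t == M + 5)) && (t.*2 <= M + 3)).

Definition consecutive (M x y : nat) : bool :=
  (y == x.+1) || (x.+1 == M) && (y == 0).

Lemma zigzagP (x y : 'I_N) :
  reflect ([|| consecutive N x y, consecutive N y x, zigzag_pair N x y
             | zigzag_pair N y x])
          ([set x; y] \in zigzag n).
Proof.
have N_gt1 : 1 < N by [].
apply: (iffP setUP) => [[/imsetP[a _ /set2_inj E]|/imsetP[i _]]|].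
- have Ea := val_succT a N_gt1; set b := succ _ a in E Ea.
  by case: E => [] [-> ->]; rewrite /consecutive Ea; case: (a.+1 =P N) => E;
    rewrite ?E ?eqxx ?orbT.
- rewrite /zigzag_edge -[1%R]/(1%:R)%R /=; set k := i./2.
  have Ei := odd_double_half i; rewrite -/k in Ei; have lti := ltn_ord i.
  have k_lt : k < N by lia.
  have E4 : (4%:R + k%:R : 'I_N)%R = 4 + k :> nat by rewrite val_addZ //; lia.
  have E2 : (2%:R - k%:R : 'I_N)%R = (if k <= 2 then 2 - k else 2 + N - k) :> nat.
    by rewrite val_subZ //; lia.
  have E1 : (1%:R - k%:R : 'I_N)%R = (if k <= 1 then 1 - k else 1 + N - k) :> nat.
    by rewrite val_subZ //; lia.
  case: (boolP (odd i)) Ei => oi Ei /=.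
    case/set2_inj=> [] [-> ->]; rewrite /zigzag_pair E4 E1;
    by move: Ei lti n_gt2; clear; case: (leqP k 1) => /=; lia.
  case/set2_inj=> [] [-> ->]; rewrite /zigzag_pair E4 E2;
  by move: Ei lti n_gt2; clear; case: (leqP k 2) => /=; lia.
suff H (a b : 'I_N) : consecutive N a b || zigzag_pair N a b ->
    [set a; b] \in boundary [set: 'I_N] \/
    [set a; b] \in [set zigzag_edge n i.+1 | i : 'I_n.+1].
  case/or4P=> Hxy; [ | rewrite setUC | | rewrite setUC]; apply: H;
  by rewrite Hxy ?orbT.
case/orP=> Hab.
  left; apply/imsetP; exists a => //; congr [set _; _]; apply: val_inj.
  rewrite /= val_succT //; move: Hab (ltn_ord b); rewrite /consecutive.
  by case: (a.+1 =P N); lia.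
right; case/andP: Hab => b_ge4 /orP[] /andP[Eab lt_b].
  (* From [b = 4 + k], the index of the edge is 2k + 1; the ordinal counts from 0, hence 2k. The
     other family has index 2k + 2. *)
  have lti : (b - 4).*2 < n.+1 by lia.
  apply/imsetP; exists (Ordinal lti) => //; rewrite /zigzag_edge /= odd_double /=.
  rewrite doubleK; congr [set _; _]; apply: ord_inj.
    rewrite val_subZ; [|lia..].
    by move: Eab (ltn_ord a) (ltn_ord b); case: (leqP (b - 4) 2); lia.
  by rewrite val_addZ; lia.
have lti : (b - 4).*2.+1 < n.+1 by lia.
apply/imsetP; exists (Ordinal lti) => //; rewrite /zigzag_edge /= odd_double /=.
rewrite uphalf_double -[1%R]/(1%:R)%R; congr [set _; _]; apply: ord_inj.
  rewrite val_subZ; [|lia..].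
  by move: Eab (ltn_ord a) (ltn_ord b); case: (leqP (b - 4) 1); lia.
by rewrite val_addZ; lia.
Qed.

Lemma zigzag_edges : zigzag n \subset edges [set: 'I_N].
Proof.
apply/subsetP=> e eZ; rewrite inE subsetT /=.
have [x [y def_e]] : exists x y, e = [set x; y].
  case/setUP: eZ => /imsetP[a _ ->]; first by exists a, (succ [set: 'I_N] a).
  by rewrite /zigzag_edge; case: ifP => _; do 2 eexists; reflexivity.
move: eZ; rewrite def_e cards2 => /zigzagP H; rewrite eqSS eqb1 -val_eqE /=.
by move: H n_gt2 (ltn_ord x) (ltn_ord y); rewrite /consecutive /zigzag_pair; clear; lia.
Qed.

End Zigzag.

Lemma deletions4 N (V : {set 'I_N}) (T : {set {set 'I_N}}) (a b c d : 'I_N) :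
  T \subset edges [set: 'I_N] -> succ V a != a -> succ (V :\ a) b != b ->
  succ (V :\ a :\ b) c != c -> succ (V :\ a :\ b :\ c) d != d ->
  deletions V T [:: a; b; c; d] =
    (V :\ a :\ b :\ c :\ d,
     collapse (contract (V :\ a :\ b :\ c) d \o (contract (V :\ a :\ b) c \o
       (contract (V :\ a) b \o contract V a))) T).
Proof.
move=> sT sa sb sc sd; rewrite /deletions.
rewrite (deletion_collapse sT sa) (deletion_collapse (collapse_edges _ _) sb).
rewrite (deletion_collapse (collapse_edges _ _) sc).
rewrite (deletion_collapse (collapse_edges _ _) sd).
by rewrite (collapse_comp _ _ sT) (collapse_comp _ _ sT) (collapse_comp _ _ sT).
Qed.

Ltac case_if := match goal with
  |- context [if ?b then _ else _] =>
    lazymatch b with context [if _ then _ else _] => fail | _ => idtac end;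
    case: (boolP b) => ? end.

(** * Both ends of the pair as collapses of one zigzag *)

Section Pair.

Variable n : nat.
Hypotheses (n_gt2 : 2 < n).
Local Notation N := n.+4.
Local Notation h := (n.+4./2).

Definition label (c : nat) (rk : nat -> nat) (x : 'I_N) : 'I_n :=
  Ordinal (ltn_pmod (c + rk x) (ltnW (ltnW n_gt2))).

(* The number of clockwise steps, among the vertices that are kept, from     *)
(* vertex 2 to the vertex that absorbs x.                                     *)
Definition rank_minus (x : nat) : nat :=
  if x <= 2 then 0 else if x < h then x - 2 else if x <= h + 2 then h - 2 else x - 4.

(** [o] is the clockwise distance from vertex 2 before deletion. The final test is a wrap-around:
    for [n] equal to 3 or 4, the deleted vertices [bar 4] and [bar 5] are 0 and 1, absorbed by
    vertex 2 itself, of rank 0. *)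
Definition rank_plus (x : nat) : nat :=
  let o := if x < 2 then x + N - 2 else x - 2 in
  let r := if o <= 1 then o else if o <= 4 then 2 else if o <= h + 2 then o - 2
           else if o <= h + 4 then h else o - 4 in
  if r == n then 0 else r.

(** The kept vertex of rank [r]; the jump skips the deleted [h] and [h + 1]. *)
Definition vertex_minus (r : nat) : nat := if r + 2 < h then r + 2 else r + 4.

Definition cyc_label (z : nat) : nat := if z < N then z else z - N.

Definition vertex_plus (r : nat) : nat :=
  cyc_label (if r <= 1 then r + 2 else if r < h then r + 4 else r + 6).

Lemma halfN : h.*2 <= N < h.*2.+2.
Proof. by have := odd_double_half N; lia. Qed.

Lemma relabel_minus (a b c d v : 'I_N) :
  a = 0 :> nat -> b = 1 :> nat -> c = h :> nat -> d = h.+1 :> nat ->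
  v = 2 :> nat ->
  let VT := deletions [set: 'I_N] (zigzag n) [:: a; b; c; d] in
  relabel n VT.1 VT.2 v 2 = collapse (label 2 rank_minus) (zigzag n).
Proof.
move=> Ea Eb Ec Ed Ev; have hN := halfN.
have sa : succ [set: 'I_N] a = 1 :> nat.
  apply: (@val_succ _ _ _ _ (isT : 1 < N)); rewrite ?inE // Ea //.
  by move=> x _; rewrite /cw; lia.
have sb : succ ([set: 'I_N] :\ a) b = 2 :> nat.
  apply: (@val_succ _ _ _ _ (isT : 2 < N)); rewrite ?inE -?val_eqE /= ?Ea ?Eb //.
  by move=> x; rewrite !inE -val_eqE /= Ea /cw; lia.
have lt1 : h.+1 < N by lia.
have lt2 : h.+2 < N by lia.
have sc : succ ([set: 'I_N] :\ a :\ b) c = h.+1 :> nat.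
  apply: (@val_succ _ _ _ _ lt1); rewrite ?inE -?val_eqE /= ?Ea ?Eb ?Ec; try lia.
  by move=> x; rewrite !inE -!val_eqE /= Ea Eb /cw; lia.
have sd : succ ([set: 'I_N] :\ a :\ b :\ c) d = h.+2 :> nat.
  apply: (@val_succ _ _ _ _ lt2); rewrite ?inE -?val_eqE /= ?Ea ?Eb ?Ec ?Ed; try lia.
  by move=> x; rewrite !inE -!val_eqE /= Ea Eb Ec /cw; lia.
move=> VT; rewrite /VT deletions4 ?zigzag_edges // -?val_eqE /= ?sa ?sb ?sc ?sd ?Ea ?Eb ?Ec ?Ed; try lia.
apply: (@relabel_rank _ _ _ _ _ _ _ _ vertex_minus rank_minus).
- exact: zigzag_edges.
- lia.
- apply: iter_succ.
  + by rewrite Ev /vertex_minus; case: leqP; lia.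
  + by move=> r; rewrite /vertex_minus; case: (leqP _ h); lia.
  + move=> r x lt_r Ex; rewrite !inE -!val_eqE /= Ex Ea Eb Ec Ed /vertex_minus.
    by case: leqP; lia.
  + move=> r x lt_r; rewrite !inE -!val_eqE /= Ea Eb Ec Ed /vertex_minus /cw.
    by case: (ltnP (r + 2) h); case: (ltnP (r.+1 + 2) h); lia.
  + move=> r lt_r; rewrite /vertex_minus.
    by case: (ltnP (r + 2) h); case: (ltnP (r.+1 + 2) h); lia.
- move=> r r' lt_r lt_r'; rewrite /vertex_minus.
  by case: (ltnP (r + 2) h); case: (ltnP (r' + 2) h); lia.
- move=> x; have := ltn_ord x; rewrite /rank_minus.
  by case: (leqP x 2); case: (ltnP x h); case: (leqP x (h + 2)); lia.
- move=> x; have ltx := ltn_ord x.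
  rewrite /= !val_contract sa sb sc sd Ea Eb Ec Ed.
  rewrite /rank_minus /vertex_minus.
  move: hN ltx n_gt2; clear => hN ltx n_gt2.
  case: (leqP x 2) => ?; [|case: (ltnP x h) => ?; [|case: (leqP x (h + 2)) => ?]].
  + rewrite [0 + 2 < h](_ : _ = true); last by lia.
    by repeat case_if; lia.
  + rewrite [x - 2 + 2 < h](_ : _ = true); last by lia.
    by repeat case_if; lia.
  + rewrite [h - 2 + 2 < h](_ : _ = false); last by lia.
    by repeat case_if; lia.
  + rewrite [x - 4 + 2 < h](_ : _ = false); last by lia.
    by repeat case_if; lia.
- by [].
Qed.

Lemma A_minusE : A_minus n = collapse (label 2 rank_minus) (zigzag n).
Proof.
have lt1 : h.+1 < N by have := halfN; lia.
apply: relabel_minus; rewrite ?(@val_natZ n 2) //.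
  by rewrite /bar GRing.add0r val_natZ modn_small // ltnW.
by rewrite /bar -[1%R]/(1%:R)%R val_addZ.
Qed.

Lemma relabel_plus (a b c d v : 'I_N) :
  a = 4 :> nat -> b = 5 :> nat -> c = cyc_label (h + 4) :> nat ->
  d = cyc_label (h + 5) :> nat -> v = 2 :> nat ->
  let VT := deletions [set: 'I_N] (zigzag n) [:: a; b; c; d] in
  relabel n VT.1 VT.2 v 1 = collapse (label 1 rank_plus) (zigzag n).
Proof.
move=> Ea Eb Ec Ed Ev; have hN := halfN.
have sa : succ [set: 'I_N] a = 5 :> nat.
  have lt5 : 5 < N by lia.
  apply: (@val_succ _ _ _ _ lt5); rewrite ?inE // Ea //.
  by move=> x _; rewrite /cw; lia.
have sb : succ ([set: 'I_N] :\ a) b = 6 :> nat.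
  have lt6 : 6 < N by lia.
  apply: (@val_succ _ _ _ _ lt6); rewrite ?inE -?val_eqE /= ?Ea ?Eb //.
  by move=> x; rewrite !inE -val_eqE /= Ea /cw; lia.
rewrite /cyc_label in Ec Ed.
have lt5 : cyc_label (h + 5) < N by rewrite /cyc_label; repeat case_if; lia.
have lt6 : cyc_label (h + 6) < N by rewrite /cyc_label; repeat case_if; lia.
have sc : succ ([set: 'I_N] :\ a :\ b) c = cyc_label (h + 5) :> nat.
  apply: (@val_succ _ _ _ _ lt5); rewrite ?inE -?val_eqE /= ?Ea ?Eb ?Ec /cyc_label.
  - by repeat case_if; lia.
  - by repeat case_if; lia.
  - by repeat case_if; lia.
  move=> x; rewrite !inE -!val_eqE /= Ea Eb /cw.
  by have := ltn_ord x; repeat case_if; lia.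
have sd : succ ([set: 'I_N] :\ a :\ b :\ c) d = cyc_label (h + 6) :> nat.
  apply: (@val_succ _ _ _ _ lt6); rewrite ?inE -?val_eqE /= ?Ea ?Eb ?Ec ?Ed /cyc_label.
  - by repeat case_if; lia.
  - by repeat case_if; lia.
  - by repeat case_if; lia.
  move=> x; rewrite !inE -!val_eqE /= Ea Eb Ec /cw.
  by have := ltn_ord x; repeat case_if; lia.
move=> VT; rewrite /VT deletions4 ?zigzag_edges // -?val_eqE /= ?sa ?sb ?sc ?sd ?Ea ?Eb ?Ec ?Ed //;
  try by rewrite /cyc_label; repeat case_if; lia.
apply: (@relabel_rank _ _ _ _ _ _ _ _ vertex_plus rank_plus).
- exact: zigzag_edges.
- lia.
- apply: iter_succ.
  + by rewrite Ev /vertex_plus /cyc_label; repeat case_if; lia.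
  + by move=> r ltr; rewrite /vertex_plus /cyc_label; repeat case_if; lia.
  + move=> r x lt_r Ex; rewrite !inE -!val_eqE /= Ex Ea Eb Ec Ed /vertex_plus /cyc_label.
    by repeat case_if; lia.
  + move=> r x lt_r; rewrite !inE -!val_eqE /= Ea Eb Ec Ed /vertex_plus /cyc_label /cw.
    have := ltn_ord x; move: lt_r hN n_gt2; clear; move: (nat_of_ord x) => {}x.
    by repeat case_if; lia.
  + by move=> r lt_r; rewrite /vertex_plus /cyc_label; repeat case_if; lia.
- by move=> r r' lt_r lt_r'; rewrite /vertex_plus /cyc_label; repeat case_if; lia.
- by move=> x; have := ltn_ord x; rewrite /rank_plus; repeat case_if; lia.
- move=> x; have ltx := ltn_ord x.
  rewrite /= !val_contract sa sb sc sd Ea Eb Ec Ed.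
  rewrite /rank_plus /vertex_plus /cyc_label.
  move: hN ltx n_gt2; clear; move: (nat_of_ord x) (n.+4./2) => {}x h hN ltx n_gt2.
  by repeat (case_if; try lia).
- by [].
Qed.

Lemma A_plusE : A_plus n = collapse (label 1 rank_plus) (zigzag n).
Proof.
have hN := halfN.
have barE k : k < 6 -> (bar (k%:R : 'I_N))%R = cyc_label (h + k) :> nat.
  move=> lt_k; rewrite /bar -GRing.natrD val_natZ addnC /cyc_label.
  case: leqP => [le_N|]; last by move=> ?; rewrite modn_small.
  by rewrite -[h + k](subnK le_N) modnDr modn_small; lia.
by apply: relabel_plus; rewrite ?barE ?val_natZ // modn_small; lia.
Qed.

End Pair.

Lemma triangulation_boundary N (T : {set {set 'I_N}}) (u v : 'I_N) :
  triangulation [set: 'I_N] T -> consecutive N u v -> u != v -> [set u; v] \in T.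
Proof.
case/triangulationP=> _ _ maxT cuv uv; apply: maxT => // c d _ ucv.
by move: cuv ucv (ltn_ord c); rewrite /consecutive /cw; lia.
Qed.

(** * Boundary steps under the labelings *)

Section LabelSteps.

Variable n : nat.
Hypothesis n_gt2 : 2 < n.
Local Notation N := n.+4.
Local Notation h := (n.+4./2).

Lemma rank_minus_lt x : x < N -> rank_minus n x < n.
Proof. by have := halfN n_gt2; rewrite /rank_minus; repeat case_if; lia. Qed.

Lemma rank_plus_lt x : x < N -> rank_plus n x < n.
Proof. by have := halfN n_gt2; rewrite /rank_plus; repeat case_if; lia. Qed.

Lemma rank_minus_step x y : x < N -> y < N -> consecutive N x y ->
  (rank_minus n x == rank_minus n y) || consecutive n (rank_minus n x) (rank_minus n y).
Proof.
have := halfN n_gt2; rewrite /consecutive /rank_minus.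
move: n_gt2; move: (n.+4./2) => k.
by repeat (case_if; try lia).
Qed.

Lemma rank_plus_step x y : x < N -> y < N -> consecutive N x y ->
  (rank_plus n x == rank_plus n y) || consecutive n (rank_plus n x) (rank_plus n y).
Proof.
have := halfN n_gt2; rewrite /consecutive /rank_plus.
move: n_gt2; move: (n.+4./2) => k.
by repeat (case_if; try lia).
Qed.

(** A kept vertex comes clockwise after the vertices it absorbs, so the step leaving it reaches the
    next rank. *)
Lemma rank_minus_lift r : r < n -> exists x y,
  [/\ x < N /\ y < N, consecutive N x y, rank_minus n x = r &
      consecutive n r (rank_minus n y)].
Proof.
move=> ltr; exists (vertex_minus n r), (cyc_label n (vertex_minus n r).+1).
have := halfN n_gt2; rewrite /consecutive /rank_minus /vertex_minus /cyc_label.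
move: ltr n_gt2; move: (n.+4./2) => k ltr n_gt2' hN.
split; [split|..]; by repeat (case_if; try lia).
Qed.

Lemma rank_plus_lift r : r < n -> exists x y,
  [/\ x < N /\ y < N, consecutive N x y, rank_plus n x = r &
      consecutive n r (rank_plus n y)].
Proof.
move=> ltr; exists (vertex_plus n r), (cyc_label n (vertex_plus n r).+1).
have := halfN n_gt2; rewrite /consecutive /rank_plus /vertex_plus /cyc_label.
move: ltr n_gt2; move: (n.+4./2) => k ltr n_gt2' hN.
split; [split|..]; by repeat (case_if; try lia).
Qed.

Variables (c : nat) (rk : nat -> nat).
Hypothesis le_cn : c <= n.
Hypothesis rk_lt : forall x, x < N -> rk x < n.

Lemma val_label (x : 'I_N) :
  label n_gt2 c rk x = (if c + rk x < n then c + rk x else c + rk x - n) :> nat.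
Proof.
have ltr := rk_lt (ltn_ord x); rewrite /= ; case: ltnP => [lt|le].
  by rewrite modn_small.
by rewrite -{1}(subnK le) modnDr modn_small //; lia.
Qed.

Lemma label_step (x y : 'I_N) :
  (rk x == rk y) || consecutive n (rk x) (rk y) ->
  (label n_gt2 c rk x == label n_gt2 c rk y)
  || consecutive n (label n_gt2 c rk x) (label n_gt2 c rk y).
Proof.
rewrite -val_eqE; change (val (label n_gt2 c rk x)) with (label n_gt2 c rk x : nat).
change (val (label n_gt2 c rk y)) with (label n_gt2 c rk y : nat).
rewrite !val_label /consecutive.
have := rk_lt (ltn_ord x); have := rk_lt (ltn_ord y); move: le_cn n_gt2.
move: (rk x) (rk y) => r r'; clear.
by repeat (case_if; try lia).
Qed.

Lemma label_lift (u v : 'I_n) :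
  (forall r, r < n -> exists x y,
     [/\ x < N /\ y < N, consecutive N x y, rk x = r & consecutive n r (rk y)]) ->
  consecutive n u v -> exists x y : 'I_N,
  [/\ consecutive N x y, label n_gt2 c rk x = u & label n_gt2 c rk y = v].
Proof.
move=> lift cuv; pose r := if c <= u then u - c else u + n - c.
have ltr : r < n by rewrite /r; have := ltn_ord u; case: (leqP c u); lia.
have [x [y [[ltx lty] cxy Ex Ey]]] := lift r ltr.
exists (Ordinal ltx), (Ordinal lty); split=> //; apply: ord_inj;
  rewrite val_label /= ?Ex; have := rk_lt lty; move: cuv Ey (ltn_ord u) (ltn_ord v) le_cn n_gt2;
  rewrite /consecutive /r; move: (rk y) (nat_of_ord u) (nat_of_ord v) => r' i j; clear;
  by repeat (case_if; try lia).
Qed.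

End LabelSteps.

(** * The reflected contraction and its effect on the pair *)

Section Fold.

Variable m : nat.
Hypothesis m_gt2 : 2 < m.

(* The reflection x |-> 5 - x modulo m, where x is represented in [2, m + 2]:  *)
(* the vertices m + 2 = 1 and 2 of the (m + 1)-gon are both sent to 3.         *)
Definition fold_val (x : nat) : nat :=
  let z := if x < 2 then 4 - x else m + 5 - x in
  if z < m then z else if z < m + m then z - m else z - (m + m).

Lemma fold_lt (x : 'I_m.+1) : fold_val x < m.
Proof. by have := ltn_ord x; rewrite /fold_val; repeat (case_if; try lia). Qed.

Definition fold (x : 'I_m.+1) : 'I_m := Ordinal (fold_lt x).

Lemma fold_cw (a b c : 'I_m.+1) : cw (fold a) (fold b) (fold c) -> cw c b a.
Proof.
move: (ltn_ord a) (ltn_ord b) (ltn_ord c) m_gt2; rewrite /= /fold_val /cw.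
move: (nat_of_ord a) (nat_of_ord b) (nat_of_ord c) => {}a {}b {}c; clear.
move=> ? ? ? ?; by repeat (case_if; try lia).
Qed.

Lemma fold_inj (p q x y : 'I_m.+1) : p = 1 :> nat -> q = 2 :> nat ->
  fold x = fold y -> x != y -> x = p /\ y = q \/ x = q /\ y = p.
Proof.
move=> Ep Eq /(congr1 (@nat_of_ord _)) /= E xy.
have H : (x == 1 :> nat) && (y == 2 :> nat) || (x == 2 :> nat) && (y == 1 :> nat).
  move: (ltn_ord x) (ltn_ord y) m_gt2 E xy; rewrite /fold_val -val_eqE /=.
  move: (nat_of_ord x) (nat_of_ord y) => {}x {}y; clear.
  move=> ? ? ?; by repeat (case_if; try lia).
case/orP: H => /andP[/eqP Ex /eqP Ey]; [left|right];
  by split; apply: ord_inj; rewrite ?Ex ?Ey ?Ep ?Eq.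
Qed.

Lemma fold_surj u : exists x, fold x = u.
Proof.
(* The map x |-> 5 - x is an involution modulo [m]; [z] is the representative of 5 - u that is at
   least 2, and [x] brings it back to a label. *)
pose z := if u <= 3 then 5 - u else m + 5 - u.
pose x := if z == m.+1 then 0 else if z <= m then z else z - m.
have ltx : x < m.+1 by have := ltn_ord u; rewrite /x /z; repeat (case_if; try lia).
exists (Ordinal ltx); apply: ord_inj; have := ltn_ord u.
by rewrite /= /fold_val /x /z; repeat (case_if; try lia).
Qed.

Lemma fold_step (x y : 'I_m.+1) : consecutive m.+1 x y ->
  (fold x == fold y) || consecutive m (fold y) (fold x).
Proof.
move: (ltn_ord x) (ltn_ord y) m_gt2; rewrite -val_eqE /= /fold_val /consecutive.
move: (nat_of_ord x) (nat_of_ord y) => {}x {}y; clear.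
move=> ? ? ?; by repeat (case_if; try lia).
Qed.

(* The i-th interior edge {s, t} of Z_(m+5) corresponds to the (i-1)-st one of *)
(* Z_(m+4), which is {6 - t, 5 - s}.                                           *)
Definition shift_t (t : nat) : nat := if t <= 6 then 6 - t else m + 10 - t.
Definition shift_s (s : nat) : nat := if s <= 1 then 5 - s else m + 10 - s.

(** By [tP] and [sP] the two maps agree along the correspondence of interior edges. The first edge
    {2, 4} has no partner: by [firstP] it has the image of the second edge {1, 4}, or falls on the
    boundary. *)
Lemma zigzag_collapse_eq (F : 'I_m.+1.+4 -> 'I_m) (G : 'I_m.+4 -> 'I_m) :
  (forall u v : 'I_m, consecutive m u v ->
     [set u; v] \in collapse F (zigzag m.+1)) ->
  (forall x y : 'I_m.+1.+4, consecutive m.+1.+4 x y ->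
     [|| F x == F y, consecutive m (F x) (F y) | consecutive m (F y) (F x)]) ->
  (forall x y : 'I_m.+4, consecutive m.+4 x y ->
     (G x == G y) || consecutive m (G x) (G y)) ->
  (forall u v : 'I_m, consecutive m u v -> exists x y : 'I_m.+4,
     [/\ consecutive m.+4 x y, G x = u & G y = v]) ->
  (forall (t : 'I_m.+1.+4) (x : 'I_m.+4), 4 <= t -> t.*2 <= m.+4 + 5 ->
     x = shift_t t :> nat -> F t = G x) ->
  (forall (s : 'I_m.+1.+4) (x : 'I_m.+4), s <= 1 \/ m + 9 <= s.*2 ->
     x = shift_s s :> nat -> F s = G x) ->
  (forall s s' t : 'I_m.+1.+4, s = 2 :> nat -> s' = 1 :> nat -> t = 4 :> nat ->
     (F s == F s') || consecutive m (F t) (F s)) ->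
  collapse F (zigzag m.+1) = collapse G (zigzag m).
Proof.
move=> bF stepF stepG liftG tP sP firstP.
have m1_gt2 : 2 < m.+1 by apply: ltnW.
have sF := zigzag_edges m1_gt2; have sG := zigzag_edges m_gt2.
have bG (u v : 'I_m) : consecutive m u v -> [set u; v] \in collapse G (zigzag m).
  move=> cuv; have [x [y [cxy Ex Ey]]] := liftG u v cuv.
  apply/(collapse2P _ _ _ sG); exists x, y; split=> //.
    by apply/zigzagP=> //; rewrite cxy.
  by rewrite -val_eqE /=; move: cuv m_gt2; rewrite /consecutive; lia.
have pairF (s t : 'I_m.+1.+4) : zigzag_pair m.+1.+4 s t -> F s != F t ->
    [set F s; F t] \in collapse G (zigzag m).
  have main (s0 : 'I_m.+1.+4) : s0 != 2 :> nat -> zigzag_pair m.+1.+4 s0 t -> F s0 != F t ->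
      [set F s0; F t] \in collapse G (zigzag m).
    move=> ns Hst Fst.
    have lt1 : shift_t t < m.+4.
      move: Hst (ltn_ord t) (ltn_ord s0); rewrite /zigzag_pair /shift_t.
      by repeat (case_if; try lia).
    have lt2 : shift_s s0 < m.+4.
      move: Hst (ltn_ord t) (ltn_ord s0); rewrite /zigzag_pair /shift_s.
      by repeat (case_if; try lia).
    apply/(collapse2P _ _ _ sG); exists (Ordinal lt2), (Ordinal lt1); split=> //.
    - apply/zigzagP=> //=; move: Hst ns (ltn_ord t) (ltn_ord s0).
      rewrite /zigzag_pair /shift_s /shift_t.
      case: (leqP s0 1) => ?; case: (leqP t 6) => ? Hst ? ? ?; apply/or4P;
      by apply: Or44; lia.
    - rewrite -(sP s0) //; move: Hst ns; rewrite /zigzag_pair; move: (ltn_ord s0); lia.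
    - rewrite -(tP t) //; move: Hst; rewrite /zigzag_pair; lia.
  move=> Hst Fst; have [Es|ns] := eqVneq (s : nat) 2; last exact: main.
  have Et : t = 4 :> nat by move: Hst (ltn_ord t); rewrite /zigzag_pair Es; lia.
  have lt1 : 1 < m.+1.+4 by [].
  case/orP: (@firstP s (Ordinal lt1) t Es erefl Et) => [/eqP E|c].
    rewrite E in Fst *; apply: main => //.
    by rewrite /zigzag_pair /= Et; lia.
  by rewrite setUC; apply: bG.
have pairG (s t : 'I_m.+4) : zigzag_pair m.+4 s t -> G s != G t ->
    [set G s; G t] \in collapse F (zigzag m.+1).
  move=> Hst Gst.
  (* [t0] and [s0] invert [shift_s] and [shift_t], exchanging the roles of the two ends. *)
  pose t0 := if s <= 2 then 6 - s else m + 10 - s.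
  pose s0 := if t <= 5 then 5 - t else m + 10 - t.
  have ltt : t0 < m.+1.+4.
    move: Hst (ltn_ord t) (ltn_ord s); rewrite /zigzag_pair /t0.
    by repeat (case_if; try lia).
  have lts : s0 < m.+1.+4.
    move: Hst (ltn_ord t) (ltn_ord s); rewrite /zigzag_pair /s0.
    by repeat (case_if; try lia).
  have Et : F (Ordinal ltt) = G s.
    apply: tP => /=; move: Hst (ltn_ord t) (ltn_ord s);
    rewrite /zigzag_pair /shift_t /t0 => *; by repeat (case_if; try lia).
  have Es : F (Ordinal lts) = G t.
    apply: sP => /=; move: Hst (ltn_ord t) (ltn_ord s);
    rewrite /zigzag_pair /shift_s /s0 => *; by repeat (case_if; try lia).
  rewrite -Et -Es; apply/(collapse2P _ _ _ sF).
  exists (Ordinal ltt), (Ordinal lts); rewrite Et Es; split=> //.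
  apply/(zigzagP m1_gt2) => /=; move: Hst (ltn_ord t) (ltn_ord s).
  rewrite /zigzag_pair /t0 /s0.
  case: (leqP s 2) => ?; case: (leqP t 5) => ? Hst ? ?; apply/or4P;
  by apply: Or44; lia.
apply/eqP; rewrite eqEsubset; apply/andP; split; apply/subsetP=> e eC;
  have [u [v [uv def_e]]] := edge_pair (collapse_edges _ _) eC;
  move: eC; rewrite def_e.
  case/(collapse2P _ _ _ sF)=> x [y [xyZ Ex Ey _]]; rewrite -Ex -Ey in uv *.
  case/(zigzagP m1_gt2)/or4P: xyZ => H.
  - case/or3P: (stepF _ _ H) => [E|/bG //|/bG]; first by rewrite E in uv.
    by rewrite setUC.
  - case/or3P: (stepF _ _ H) => [E|/bG|/bG //]; last by rewrite setUC.
      by rewrite eq_sym E in uv.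
  - exact: pairF.
  - by rewrite setUC; apply: pairF; rewrite // eq_sym.
case/(collapse2P _ _ _ sG)=> x [y [xyZ Ex Ey _]]; rewrite -Ex -Ey in uv *.
case/(zigzagP m_gt2)/or4P: xyZ => H.
- by case/orP: (stepG _ _ H) => [E|/bF //]; rewrite E in uv.
- case/orP: (stepG _ _ H) => [E|/bF]; last by rewrite setUC.
  by rewrite eq_sym E in uv.
- exact: pairG.
- by rewrite setUC; apply: pairG; rewrite // eq_sym.
Qed.

Let m1_gt2 : 2 < m.+1 := ltnW m_gt2.

Lemma step_fold_label c rk : c <= m.+1 ->
  (forall x, x < m.+1.+4 -> rk x < m.+1) ->
  (forall x y, x < m.+1.+4 -> y < m.+1.+4 -> consecutive m.+1.+4 x y ->
     (rk x == rk y) || consecutive m.+1 (rk x) (rk y)) ->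
  let F := fold \o label m1_gt2 c rk in
  forall x y : 'I_m.+1.+4, consecutive m.+1.+4 x y ->
  [|| F x == F y, consecutive m (F x) (F y) | consecutive m (F y) (F x)].
Proof.
move=> le_c rk_lt rk_step F x y cxy; rewrite /F /=.
have /orP[/eqP->|/fold_step/orP[->|->]] :=
  label_step m1_gt2 le_c rk_lt (rk_step x y (ltn_ord x) (ltn_ord y) cxy).
- by rewrite eqxx.
- by [].
- by rewrite !orbT.
Qed.

Lemma boundary_collapse (F : 'I_m.+1.+4 -> 'I_m) :
  triangulation [set: 'I_m] (collapse F (zigzag m.+1)) ->
  forall u v : 'I_m, consecutive m u v ->
  [set u; v] \in collapse F (zigzag m.+1).
Proof.
move=> triF u v cuv; apply: (triangulation_boundary triF cuv).
by rewrite -val_eqE /=; move: cuv m_gt2; rewrite /consecutive; lia.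
Qed.

Lemma val_fold_label c rk (x : 'I_m.+1.+4) : c <= m.+1 ->
  (forall x, x < m.+1.+4 -> rk x < m.+1) ->
  fold (label m1_gt2 c rk x)
    = fold_val (if c + rk x < m.+1 then c + rk x else c + rk x - m.+1) :> nat.
Proof. by move=> le_c rk_lt; rewrite -(val_label m1_gt2 le_c rk_lt). Qed.

(** The fold adds vertex m + 4 to the class of 0, 1, 2. Under s |-> 5 - s the vertices m + 4, 0, 1
    become 6, 5, 4, a class merged in A_m^+. The triangulation hypothesis supplies the boundary
    edges. *)
Lemma fold_A_minus :
  triangulation [set: 'I_m] (collapse fold (A_minus m.+1)) ->
  collapse fold (A_minus m.+1) = A_plus m.
Proof.
rewrite (A_minusE m1_gt2) (A_plusE m_gt2) (collapse_comp _ _ (zigzag_edges m1_gt2)).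
move=> triF.
have lt1 := rank_minus_lt m1_gt2; have lt2 := rank_plus_lt m_gt2.
have le1 : 2 <= m.+1 by lia. have le2 : 1 <= m by lia.
have hm1 := halfN m1_gt2; have hm := halfN m_gt2.
apply: zigzag_collapse_eq.
- exact: boundary_collapse.
- by apply: step_fold_label => //; apply: rank_minus_step.
- move=> x y cxy; apply: label_step => //; exact: rank_plus_step.
- by move=> u v; apply: label_lift => //; apply: rank_plus_lift.
- move=> t x t_ge4 le_t Ex; apply: ord_inj.
  rewrite [LHS]val_fold_label // val_label // Ex.
  move: t_ge4 le_t (ltn_ord t) m_gt2 hm1 hm.
  rewrite /shift_t /fold_val /rank_minus /rank_plus.
  move: (m.+1.+4./2) (m.+4./2) (nat_of_ord t) => h h' k; clear.
  by move=> ? ? ? ? ? ?; repeat (case_if; try lia).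
- move=> s x le_s Ex; apply: ord_inj.
  rewrite [LHS]val_fold_label // val_label // Ex.
  move: le_s (ltn_ord s) m_gt2 hm1 hm.
  rewrite /shift_s /fold_val /rank_minus /rank_plus.
  move: (m.+1.+4./2) (m.+4./2) (nat_of_ord s) => h h' k; clear.
  by move=> ? ? ? ? ?; repeat (case_if; try lia).
(* Vertex 1 has been absorbed by vertex 2. *)
- move=> s s' t Es Es' Et; apply/orP; left; apply/eqP; apply: ord_inj.
  by rewrite [LHS]val_fold_label // [RHS]val_fold_label // Es Es'.
Qed.

(** The merged vertices 4, 5, 6 become 2, 1, 0 under t |-> 6 - t, a class merged in A_m^-. *)
Lemma fold_A_plus :
  triangulation [set: 'I_m] (collapse fold (A_plus m.+1)) ->
  collapse fold (A_plus m.+1) = A_minus m.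
Proof.
rewrite (A_plusE m1_gt2) (A_minusE m_gt2) (collapse_comp _ _ (zigzag_edges m1_gt2)).
move=> triF.
have lt1 := rank_plus_lt m1_gt2; have lt2 := rank_minus_lt m_gt2.
have le1 : 1 <= m.+1 by lia. have le2 : 2 <= m by lia.
have hm1 := halfN m1_gt2; have hm := halfN m_gt2.
apply: zigzag_collapse_eq.
- exact: boundary_collapse.
- by apply: step_fold_label => //; apply: rank_plus_step.
- move=> x y cxy; apply: label_step => //; exact: rank_minus_step.
- by move=> u v; apply: label_lift => //; apply: rank_minus_lift.
- move=> t x t_ge4 le_t Ex; apply: ord_inj.
  rewrite [LHS]val_fold_label // val_label // Ex.
  move: t_ge4 le_t (ltn_ord t) m_gt2 hm1 hm.
  rewrite /shift_t /fold_val /rank_minus /rank_plus.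
  move: (m.+1.+4./2) (m.+4./2) (nat_of_ord t) => h h' k; clear.
  by move=> ? ? ? ? ? ?; repeat (case_if; try lia).
- move=> s x le_s Ex; apply: ord_inj.
  rewrite [LHS]val_fold_label // val_label // Ex.
  move: le_s (ltn_ord s) m_gt2 hm1 hm.
  rewrite /shift_s /fold_val /rank_minus /rank_plus.
  move: (m.+1.+4./2) (m.+4./2) (nat_of_ord s) => h h' k; clear.
  by move=> ? ? ? ? ?; repeat (case_if; try lia).
(* Vertices 2 and 3 carry the labels 1 and 2 and are merged by the fold. Hence the images of 2 and 4
   become neighbours, in reversed order. *)
- move=> s s' t Es Es' Et; apply/orP; right.
  rewrite [X in consecutive _ X _]val_fold_label //.
  rewrite [X in consecutive _ _ X]val_fold_label // Es Et.
  move: m_gt2 hm1; rewrite /rank_plus /fold_val /consecutive.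
  move: (m.+1.+4./2) => h; clear.
  by move=> ? ?; repeat (case_if; try lia).
Qed.

End Fold.

(** * Reversal of paths and conclusion *)

Lemma path_triangulation N (T : {set {set 'I_N}}) s :
  path (flip [set: 'I_N]) T s -> triangulation [set: 'I_N] T ->
  triangulation [set: 'I_N] (last T s).
Proof.
by elim: s T => //= T' s IHs T /andP[/and3P[_ triT' _] /IHs IH] _; apply: IH.
Qed.

Lemma flip_path_rev N (T : {set {set 'I_N}}) s :
  path (flip [set: 'I_N]) T s ->
  exists s', [/\ path (flip [set: 'I_N]) (last T s) s', last (last T s) s' = T &
                 size s' = size s].
Proof.
move=> path_s; exists (rev (belast T s)); split.
- rewrite rev_path; apply: sub_path path_s => U U'; by rewrite flip_sym.
- by case: s {path_s} => //= T' s; rewrite rev_cons last_rcons.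
- by rewrite size_rev size_belast.
Qed.

Theorem theorem6 (n : nat) (n_gt3 : 3 < n) :
  2 <= theta [set: 'I_n] (A n) (Ordinal (ltnW (ltnW n_gt3) : 1 < n)) ->
  delta [set: 'I_n] (A n) >= delta [set: 'I_n.-1] (A n.-1) + 2.
Proof.
case: n n_gt3 => [//|m] m_gt2 /=; set p := Ordinal _ => theta2.
have [s Ps s2] : exists2 s : (delta [set: 'I_m.+1] (A m.+1)).-tuple _,
    flip_path [set: 'I_m.+1] (A m.+1) s &
    2 <= nb_incident [set: 'I_m.+1] p (A m.+1).1 s.
  (* A maximum that is at least 2 is attained; the value 0 of an empty maximum is excluded. *)
  move: theta2; rewrite /theta; elim/big_ind: _ => // [x y IHx IHy|s Ps s2].
    by rewrite leq_max => /orP[].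
  by exists s.
have lt2 : 2 < m.+1 by apply: ltnW.
pose q : 'I_m.+1 := Ordinal lt2.
have def_q : q = succ [set: 'I_m.+1] p.
  apply: ord_inj; rewrite (val_succT p (ltnW lt2)) ifN //= eqSS.
  by move: (m_gt2); clear; lia.
have neq_pq : p != q by [].
have adj z : ~~ cw p z q by rewrite /cw /=; lia.
have fpq : fold m_gt2 p = fold m_gt2 q.
  by apply: ord_inj; rewrite /= /fold_val /=; repeat (case_if; try lia).
have finj := fold_inj (erefl : p = 1 :> nat) (erefl : q = 2 :> nat).
have fsurj := fold_surj m_gt2.
have /andP[path_s /eqP last_s] := Ps.
have [s' [path_s' last_s' sz]] := collapse_path (@fold_cw m m_gt2) fpq (finj _) fsurj
  adj neq_pq (ltnW lt2) def_q path_s.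
have tri T : triangulation [set: 'I_m.+1] T -> triangulation [set: 'I_m] (collapse (fold m_gt2) T).
  exact: collapse_triangulation (@fold_cw m m_gt2) fpq (finj _) fsurj adj neq_pq _.
have [triM triP] : triangulation [set: 'I_m.+1] (A_minus m.+1) /\
    triangulation [set: 'I_m.+1] (A_plus m.+1).
  (* Two incident flips make the path nonempty, and flips only join triangulations, so both ends of
     the pair are triangulations. *)
  move: path_s last_s s2; rewrite /flip_path; case: (tval s) => //= T s1.
  case/andP=> /and3P[tM tT _] pT <- _; split=> //.
  exact: path_triangulation pT tT.
have path_r := flip_path_rev path_s'.
rewrite last_s' last_s /= in path_r.
(* The folded path runs from A_m^+ to A_m^-; its reversal has the order required by [A m]. *)
rewrite (fold_A_minus (tri _ triM)) (fold_A_plus (tri _ triP)) in path_r.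
have [s1 [p1 l1 sz1]] := path_r.
have Ps1 : flip_path [set: 'I_m] (A m) s1 by rewrite /flip_path p1 l1 eqxx.
have [_ /(_ _ Ps1) le_delta] := deltaP Ps1.
move: sz s2; rewrite size_tuple; move: le_delta; rewrite sz1.
by move: (nb_incident _ _ _ _) => k; lia.
Qed.
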